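(* For any type $\sigma$ and any sequence of blocks $\delta=(d_1^{m_1},\ldots,d_s^{m_s})$, \[ p_{\sigma}^{\otimes}E^+_{\delta}=\sum_{\tau} \left[\sum_{T\in\mathrm{ICRHT}(\tau,(\sigma;\delta))} \operatorname{sgn}^+(T)\operatorname{wt}(T)\right] p_{\tau}^{\otimes}; \] \[ p_{\sigma}^{\otimes}E_{\delta}=\sum_{\tau} \left[\sum_{T\in\mathrm{ICRHT}(\tau,(\sigma;\delta))} \operatorname{sgn}^-(T)\operatorname{wt}(T)\right] p_{\tau}^{\otimes}, \] where the outer sums are over types $\tau$ and $\mathrm{ICRHT}(\tau,(\sigma;\delta))$ is the set of increasing constant-row $H$-tableaux of shape $\tau$ and extended content $(\sigma;\delta)$.
   Context: An integer partition is a finite (possibly empty) weakly decreasing sequence of positive integers; $m_i(\lambda)$ is the number of parts of $\lambda$ equal to $i$, and $z_\lambda=\prod_{i\ge1}i^{m_i(\lambda)}m_i(\lambda)!$. A block is an ordered pair of positive integers written $d^m$ (degree $d$, multiplicity $m$). Blocks are ordered by $a^b\ge d^e$ iff $a>d$, or $a=d$ and $b\ge e$. A type is a finite (possibly empty) weakly decreasing sequence of blocks $\tau=(a_1^{b_1},\dots,a_t^{b_t})$; $\tau\Vdash n$ means $\sum_ia_ib_i=n$; its length is $\ell(\tau)=t$ and its sign is $\operatorname{sgn}(\tau)=\prod_{i=1}^t(-1)^{b_i}$. For $k\ge1$, $\tau|_k$ denotes the integer partition formed by the multiplicities of the blocks of $\tau$ of degree $k$; the type $\tau$ is determined by $(\tau|_k)_{k\ge1}$.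 Put $z^\otimes_\tau=\prod_{k\ge1}z_{\tau|_k}$. The tensor diagram of $\tau$ is the sequence of partition diagrams $\mathrm{dg}(\tau|_1)\otimes\mathrm{dg}(\tau|_2)\otimes\cdots$; the $k$th component has rows (left-justified, longest at top) of lengths the parts of $\tau|_k$. Variables: $x_{k,j}$ for $k,j\ge 1$, with $\deg x_{k,j}=k$; $\mathbf{x}_{k*}=(x_{k,1},x_{k,2},\dots)$. The algebra $\mathsf{P\Lambda}$ of polysymmetric functions consists of the formal series over $\mathbb{Q}$ of bounded degree in all the $x_{k,j}$ that, for each fixed $k$, are unchanged by any permutation of the variables $\mathbf{x}_{k*}$. Define $p^{\otimes}_\tau=\prod_{k\ge1}p_{\tau|_k}(\mathbf{x}_{k*})$, where $p_\lambda$ is the power-sum symmetric function. $E^+_d$ is the sum of all square-free monomials (no variable repeated) of degree $d$ in the variables $x_{k,j}$ (with $\deg x_{k,j}=k$); $E_d$ is the sum of the same monomials, each multiplied by $(-1)^q$ where $q$ is the number of variables in the monomial. $E^+_{d^m}$ and $E_{d^m}$ are obtained from $E^+_d$ and $E_d$ by replacing every variable $x_{k,j}$ by $x_{k,j}^m$; $E^+_\delta=\prod_{i=1}^sE^+_{d_i^{m_i}}$ and $E_\delta=\prod_{i=1}^sE_{d_i^{m_i}}$. An increasing constant-row $H$-tableau (ICRHT) of shape $\tau$ and extended content $(\sigma;\delta)$, where $\delta=(d_1^{m_1},\dots,d_s^{m_s})$, is a filling $T$ of the cells of the tensor diagram of $\tau$ with integers $0,1,\dots,s$ such that: (i) each row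 of each component is constant; (ii) the cells containing $0$ form a sub-tensor diagram equal to that of $\sigma$, i.e., for each $k$ the multiset of lengths of the rows of component $k$ filled with $0$ is the multiset of parts of $\sigma|_k$; (iii) for $1\le i\le s$, the cells containing $i$ form a sub-tensor diagram equal to $\mathrm{dg}(m_i\rho^{(i)})$ for some type $\rho^{(i)}\Vdash d_i$, i.e., for each $k$ the multiset of lengths of the rows of component $k$ filled with $i$ is the multiset of parts of $\rho^{(i)}|_k$ each multiplied by $m_i$; (iv) for each $r,k$, the values in the rows of length $r$ in component $k$ weakly increase reading down the first column. The weight is $\operatorname{wt}(T)=\prod_{i=1}^s1/z^\otimes_{\rho^{(i)}}$, and the signs are $\operatorname{sgn}^+(T)=\prod_{i=1}^s(-1)^{\ell(\rho^{(i)})}\operatorname{sgn}(\rho^{(i)})$ and $\operatorname{sgn}^-(T)=\prod_{i=1}^s(-1)^{\ell(\rho^{(i)})}$. *)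

(* Defs.v *)
From HB Require Import structures.
From mathcomp Require Import all_boot all_order all_algebra.
From mathcomp Require Import finmap multiset.
From mathcomp Require Import boolp classical_sets functions fsbigop.

Set Implicit Arguments.
Unset Strict Implicit.
Unset Printing Implicit Defensive.

Import GRing.Theory.

Local Open Scope ring_scope.

Record posnat := Posnat { pval :> nat; pvalP : (0 < pval)%N }.
HB.instance Definition _ := [isSub for pval].
HB.instance Definition _ := [Countable of posnat by <:].

(* The block d^m is the pair (d, m). *)
Definition block : Type := (posnat * posnat)%type.

Definition geblock (a b : block) : bool :=
  (b.1 < a.1)%N || (a.1 == b.1) && (b.2 <= a.2)%N.

Record ptype := PType { blocks :> seq block; _ : sorted geblock blocks }.
HB.instance Definition _ := [isSub for blocks].
HB.instance Definition _ := [Countable of ptype by <:].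

Definition ptype0 : ptype := @PType [::] isT.

(* tau ||- n  is  type_size tau = n. *)
Definition type_size (tau : ptype) : nat := (\sum_(b <- tau) b.1 * b.2)%N.

Definition tsgn (tau : ptype) : rat := \prod_(b <- tau) (-1) ^+ b.2.

(* tau|_k; it is weakly decreasing because tau is, see restr_sorted. *)
Definition restr (tau : ptype) (k : posnat) : seq posnat :=
  [seq b.2 | b <- tau & b.1 == k].

Definition degrees (tau : ptype) : seq posnat := undup [seq b.1 | b <- tau].

(* Factors i with m_i(lambda) = 0, and components k with tau|_k empty, contribute 1, so
   the products over all i, k >= 1 run over the values that occur. *)
Definition zpart (lam : seq posnat) : nat :=
  (\prod_(i <- undup lam) (i ^ count_mem i lam * (count_mem i lam)`!))%N.

Definition ztens (tau : ptype) : nat := (\prod_(k <- degrees tau) zpart (restr tau k))%N.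

Lemma geblock_trans : transitive geblock.
Proof.
move=> [b1 b2] [a1 a2] [c1 c2]; rewrite /geblock /= -!val_eqE /=.
case/orP=> [h1|/andP[/eqP h1 h1']]; case/orP=> [h2|/andP[/eqP h2 h2']].
- by rewrite (ltn_trans h2 h1).
- by rewrite -h2 h1.
- by rewrite h1 h2.
- by rewrite h1 h2 eqxx (leq_trans h2' h1') orbT.
Qed.

Lemma geblock_anti : antisymmetric geblock.
Proof.
move=> [a1 a2] [b1 b2]; rewrite /geblock /= -!val_eqE /= => h.
have e1 : pval a1 = pval b1.
  by case: (ltngtP a1 b1) h => //=; rewrite andbF.
move: h; rewrite e1 ltnn eqxx /= -eqn_leq => /eqP e2.
by congr pair; apply/val_inj.
Qed.

Lemma restr_sorted (tau : ptype) (k : posnat) :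
  sorted (fun a b : posnat => b <= a)%N (restr tau k).
Proof.
case: tau => s /= hs; rewrite /restr /= sorted_map.
have := sorted_filter geblock_trans (fun b : block => b.1 == k) hs.
have : all (fun b : block => b.1 == k) [seq b <- s | b.1 == k] by exact: filter_all.
case: [seq b <- s | b.1 == k] => //= x t; elim: t x => //= y t IH x.
case/and3P=> /eqP hx /eqP hy ht /andP[hxy hp].
apply/andP; split; last by apply: IH => //; rewrite hy eqxx.
by move: hxy; rewrite /geblock hx hy ltnn /= => /andP[].
Qed.

Lemma ptype_eq (t u : ptype) : (forall k, perm_eq (restr t k) (restr u k)) -> t = u.
Proof.
move=> h; apply/val_inj; apply: (sorted_eq geblock_trans geblock_anti (valP t) (valP u)).
apply/allP => -[k r] _; apply/eqP.
have E (v : ptype) : count_mem (k, r) (val v) = count_mem r (restr v k).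
  rewrite /restr count_map count_filter; apply: eq_count => -[a b] /=.
  by rewrite xpair_eqE andbC.
by rewrite !E; exact: (seq.permP (h k)).
Qed.

(* The variable x_{k,j} is the pair (k, j); a monomial is the finite multiset of its
   variables, and the product of monomials is the sum `+` of multisets. *)
Definition var : Type := (posnat * posnat)%type.

Notation mono := {mset var}%mset.

Definition mdeg (M : mono) : nat := (\sum_(x <- (M : seq var)) x.1)%N.

Definition mdivisors (M : mono) : {fset mono} :=
  [fset (seq_mset (mask (tval b) M) : mono) | b in {: (size M).-tuple bool}]%fset.

Lemma mem_mdivisors (M A : mono) : (A \in mdivisors M) = (A `<=` M)%mset.
Proof.
apply/imfsetP/msubsetP => /=.
  move=> [b _ ->] x; rewrite mset_seqE -[leqRHS]count_mem_mset.
  by apply: leq_count_subseq; apply: mask_subseq.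
move=> h; have : forall x, (count_mem x A <= count_mem x M)%N.
  by move=> x; rewrite !count_mem_mset.
move=> /count_subseqP[s /subseqP[m hm ->] /eq_seq_msetP hA].
exists (tcast hm (in_tuple m)) => //.
by rewrite val_tcast /= -hA seq_mset_id.
Qed.

Definition series : Type := mono -> rat^o.

HB.instance Definition _ := GRing.Lmodule.copy series (mono -> rat^o).

Definition series1 : series := fun M => (M == mset0)%:R.

Definition seriesM (f g : series) : series :=
  fun M => \sum_(A <- mdivisors M) f A * g (M `\` A)%mset.

Lemma seriesMC : commutative seriesM.
Proof.
move=> f g; apply/funext => M; rewrite /seriesM.
pose h (A : mono) : mono := (M `\` A)%mset.
have P : perm_eq (mdivisors M) (map h (mdivisors M)).
  apply: uniq_perm => [||A]; first exact: fset_uniq.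
    rewrite map_inj_in_uniq ?fset_uniq // => A B.
    rewrite !mem_mdivisors => hA hB e.
    by rewrite -(msetBBK hA) -(msetBBK hB) -/(h A) e.
  rewrite mem_mdivisors; apply/idP/mapP => [hA|[B _ ->]].
    by exists (h A); rewrite ?mem_mdivisors ?msubsetDl // /h msetBBK.
  exact: msubsetDl.
rewrite (perm_big _ P) big_map big_seq [RHS]big_seq; apply: eq_bigr => A.
by rewrite mem_mdivisors => hA; rewrite /h msetBBK // mulrC.
Qed.

Lemma series1M : left_id series1 seriesM.
Proof.
move=> f; apply/funext => M; rewrite /seriesM.
have h0 : (mset0 : mono) \in mdivisors M by rewrite mem_mdivisors msub0set.
rewrite (bigD1_seq (mset0 : mono)) ?fset_uniq //= /series1 eqxx mul1r msetB0.
by rewrite big1 ?addr0 // => A /negPf ->; rewrite mul0r.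
Qed.

Lemma seriesMDl : left_distributive seriesM +%R.
Proof.
move=> f g h; apply/funext => M.
rewrite /seriesM -[RHS]/(_ + _ : rat) -big_split /=.
by apply: eq_bigr => A _; rewrite -mulrDl.
Qed.

Lemma seriesMA : associative seriesM.
Proof.
move=> f g h; apply/funext => M; rewrite /seriesM; symmetry.
transitivity (\sum_(A <- mdivisors M) \sum_(B <- mdivisors M | (B `<=` A)%mset)
    f B * g (A `\` B)%mset * h (M `\` A)%mset).
  rewrite big_seq [RHS]big_seq; apply: eq_bigr => A hA.
  rewrite mulr_suml -[in RHS]big_filter; apply: perm_big.
  apply: uniq_perm; rewrite ?filter_uniq ?fset_uniq // => B.
  rewrite mem_filter !mem_mdivisors; case hB: (B `<=` A)%mset => //=.
  by symmetry; apply: msubset_trans hB _; rewrite -mem_mdivisors.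
rewrite (exchange_big_dep predT) //= big_seq [RHS]big_seq; apply: eq_bigr => B hB.
rewrite mulr_sumr -big_filter.
have hE (F : mono -> rat) : \sum_(A <- [seq A <- mdivisors M | (B `<=` A)%mset]) F A =
    \sum_(A <- [seq (B `+` C)%mset : mono | C <- mdivisors (M `\` B)%mset]) F A.
  move: hB; rewrite mem_mdivisors => hB; apply: perm_big.
  apply: uniq_perm; rewrite ?filter_uniq ?fset_uniq //.
    by rewrite map_inj_uniq ?fset_uniq //; apply: can_inj (msetDKB B).
  move=> A; rewrite mem_filter mem_mdivisors; apply/andP/mapP => [[hBA hAM]|[C]].
    exists (A `\` B)%mset; first by rewrite mem_mdivisors msetSB.
    by rewrite msetBDKC.
  rewrite mem_mdivisors => hC ->; split.
    by apply/msubsetP => x; rewrite msetE2 leq_addr.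
  by rewrite -(msetBDKC hB) msetDS.
rewrite hE big_map; apply: eq_bigr => C _.
by rewrite msetDKB msetBDA mulrA.
Qed.

Lemma series1_neq0 : series1 != 0.
Proof.
apply/eqP => /(congr1 (fun f : series => f mset0)); rewrite /series1 eqxx.
by move/eqP; rewrite oner_eq0.
Qed.

HB.instance Definition _ := GRing.Zmodule_isComNzRing.Build series
  seriesMA seriesMC series1M seriesMDl series1_neq0.

Lemma seriesZAl (a : rat) (f g : series) : a *: (f * g) = (a *: f) * g.
Proof.
apply/funext => M; rewrite -[LHS]/(a * \sum_(A <- _) _) mulr_sumr.
by apply: eq_bigr => A _; rewrite mulrA.
Qed.

HB.instance Definition _ := GRing.Lmodule_isLalgebra.Build rat series seriesZAl.
HB.instance Definition _ := GRing.Lalgebra_isComAlgebra.Build rat series.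

(* The substitution x_{k,j} |-> x_{k,g(j)} for one fixed degree k. *)
Definition permvar (k : posnat) (g : posnat -> posnat) (x : var) : var :=
  if x.1 == k then (k, g x.2) else x.

Definition rename (h : var -> var) (M : mono) : mono :=
  seq_mset [seq h x | x <- (M : seq var)].

Definition bounded_degree (f : series) : Prop :=
  exists n : nat, forall M, f M != 0 -> (mdeg M <= n)%N.

Definition symmetric_in (k : posnat) (f : series) : Prop :=
  forall g, bijective g -> forall M, f (rename (permvar k g) M) = f M.

Definition polysym : {pred series} :=
  fun f => `[< bounded_degree f /\ forall k, symmetric_in k f >].

Lemma polysymP f :
  reflect (bounded_degree f /\ forall k, symmetric_in k f) (f \in polysym).
Proof. exact: asboolP. Qed.

Lemma permvar_bij k g : bijective g -> bijective (permvar k g).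
Proof.
move=> [g' gK g'K]; exists (permvar k g') => -[a j]; rewrite /permvar /=;
by case: (eqVneq a k) => [->|/negPf h] /=; rewrite ?eqxx ?h ?gK ?g'K.
Qed.

Lemma perm_rename h (M : mono) : perm_eq (rename h M) [seq h x | x <- (M : seq var)].
Proof. exact: perm_eq_seq_mset. Qed.

Lemma renameE h h' (M : mono) x : cancel h h' -> cancel h' h ->
  rename h M x = M (h' x).
Proof.
move=> hK h'K; rewrite mset_seqE count_map -[RHS]count_mem_mset.
by apply: eq_count => y /=; apply/eqP/eqP => [<-|->].
Qed.

Lemma renameK h h' : cancel h h' -> cancel h' h -> cancel (rename h) (rename h').
Proof.
by move=> hK h'K M; apply/msetP => x; rewrite (renameE _ _ h'K hK) (renameE _ _ hK h'K) hK.
Qed.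

Lemma mdeg_rename k g (M : mono) : mdeg (rename (permvar k g) M) = mdeg M.
Proof.
rewrite /mdeg (perm_big _ (perm_rename _ _)) big_map; apply: eq_bigr => x _.
by rewrite /permvar; case: eqP => [->|].
Qed.

Lemma mdegE (M : mono) : mdeg M = (\sum_(x <- finsupp M) M x * x.1)%N.
Proof. by rewrite /mdeg sum_mset. Qed.

Lemma mdegD (A B : mono) : mdeg (A `+` B)%mset = (mdeg A + mdeg B)%N.
Proof.
rewrite /mdeg -big_cat; apply: perm_big; apply/seq.permP => p.
have h x : count_mem x (A `+` B)%mset = count_mem x ((A : seq var) ++ B).
  by rewrite count_cat !count_mem_mset msetE2.
by move: p; apply/seq.permP; apply/allP => x _; rewrite /= h.
Qed.

Lemma polysym_subalg : subalg_closed polysym.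
Proof.
split.
- apply/polysymP; split=> [|k g gbij M].
    exists 0%N => M; rewrite -[(1 : series) M]/(series1 M) /series1.
    have [-> _|_] := eqVneq M mset0; last by rewrite eqxx.
    by rewrite /mdeg enum_mset0 big_nil.
  rewrite -![(1 : series) _]/(series1 _) /series1; congr (_%:R).
  by rewrite -!size_mset_eq0 (perm_size (perm_rename _ _)) size_map.
- move=> a f g /polysymP[[nf hf] sf] /polysymP[[ng hg] sg]; apply/polysymP; split.
    exists (maxn nf ng) => M; rewrite -[(a *: f + g) M]/(a * f M + g M) => h.
    have [f0|/hf hn] := eqVneq (f M) 0; last by rewrite leq_max hn.
    by rewrite leq_max hg ?orbT //; move: h; rewrite f0 mulr0 add0r.
  move=> k h hb M; rewrite -![(a *: f + g) _]/(a * f _ + g _).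
  by rewrite sf ?sg.
- move=> f g /polysymP[[nf hf] sf] /polysymP[[ng hg] sg]; apply/polysymP; split.
    exists (nf + ng)%N => M; rewrite -[(f * g) M]/(seriesM f g M).
    apply: contraNT; rewrite -ltnNge => hM; rewrite /seriesM big_seq big1 // => A.
    rewrite mem_mdivisors => hA; apply/eqP; rewrite mulf_eq0 -implyNb.
    apply/implyP => /hf h1; apply: contraLR hM => /hg h2; rewrite -leqNgt.
    by rewrite -(msetBDKC hA) mdegD leq_add.
  move=> k p pb M; rewrite -![(f * g) _]/(seriesM f g _) /seriesM.
  have [q pK qK] := permvar_bij k pb; set h := permvar k p in pK qK *.
  have P : perm_eq (mdivisors (rename h M)) [seq rename h A | A <- mdivisors M].
    apply: uniq_perm => [||A]; first exact: fset_uniq.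
      by rewrite map_inj_uniq ?fset_uniq //; apply: can_inj (renameK pK qK).
    rewrite mem_mdivisors; apply/msubsetP/mapP => [hA|[B]].
      exists (rename q A); last by rewrite (renameK qK pK).
      rewrite mem_mdivisors; apply/msubsetP => x; rewrite (renameE _ _ qK pK).
      by apply: leq_trans (hA _) _; rewrite (renameE _ _ pK qK) pK.
    rewrite mem_mdivisors => /msubsetP hB -> x.
    by rewrite !(renameE _ _ pK qK).
  rewrite (perm_big _ P) big_map; apply: eq_bigr => A _; rewrite sf //.
  congr (_ * _); rewrite -(sg k p pb (M `\` A)%mset) -/h; congr (g _).
  by apply/msetP => x; rewrite msetE2 !(renameE _ _ pK qK) msetE2.
Qed.

HB.instance Definition _ := GRing.isSubalgClosed.Build rat series polysym polysym_subalg.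

Record PLambda := PolySym { pser :> series; _ : pser \in polysym }.
HB.instance Definition _ := [isSub for pser].
HB.instance Definition _ := [Choice of PLambda by <:].
HB.instance Definition _ := [SubChoice_isSubAlgebra of PLambda by <:].
HB.instance Definition _ := [SubNzRing_isSubComNzRing of PLambda by <:].


(* p_r(x_{k*}): the coefficient of M is 1 if M = x_{k,j}^r for some j, and 0 otherwise. *)
Definition psum_series (k r : posnat) : series :=
  fun M => `[< exists j : posnat, M = msetn r (k, j) >]%:R.

(* The sum of the square-free monomials of degree d, each times eps^(number of
   variables): eps = 1 gives E^+_d and eps = -1 gives E_d. *)
Definition sqfree_series (eps : rat) (d : nat) : series :=
  fun M => if uniq M && (mdeg M == d) then eps ^+ size M else 0.

(* The substitution of x_{k,j}^m for every x_{k,j}: the coefficient of M in the result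
   is that of M^(1/m) in f if M is an m-th power, and 0 otherwise. *)
Definition mroot (m : posnat) (M : mono) : mono :=
  [fsfun x in finsupp M => (M x %/ m)%N].

Definition pow_subst_series (m : posnat) (f : series) : series :=
  fun M => if all (fun x => m %| M x)%N M then f (mroot m M) else 0.

Lemma mrootE m (M : mono) x : mroot m M x = (M x %/ m)%N.
Proof.
rewrite /mroot fsfunE; case: ifP => // /negbT.
by rewrite memNfinsupp => /eqP ->; rewrite div0n.
Qed.

Lemma rename_msetn h n (x : var) : rename h (msetn n x) = msetn n (h x).
Proof.
apply/msetP => y; rewrite -[LHS]count_mem_mset -[RHS]count_mem_mset.
by rewrite (seq.permP (perm_rename _ _)) !enum_msetn map_nseq.
Qed.

Lemma psum_polysym k r : psum_series k r \in polysym.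
Proof.
apply/polysymP; split.
  exists (r * k)%N => M; rewrite /psum_series; case: asboolP => [[j ->] _|_]; last first.
    by rewrite eqxx.
  by rewrite /mdeg enum_msetn big_nseq iter_addn addn0 mulnC.
move=> k' g gb M; have [h gK hK] := permvar_bij k' gb.
rewrite /psum_series; congr (nat_of_bool _)%:R; apply: asbool_equiv_eq; split=> -[j].
  move=> /(congr1 (rename h)); rewrite (renameK gK hK) rename_msetn => ->.
  move: (hK (k, j)); case: (h (k, j)) => a b; rewrite /permvar /=.
  by case: eqP => [-> [<- _]|_ [-> _]]; [exists b|exists b].
move=> ->; rewrite rename_msetn /permvar /=.
by case: eqP => [<-|_]; [exists (g j)|exists j].
Qed.

Lemma sqfree_polysym eps d : sqfree_series eps d \in polysym.
Proof.
apply/polysymP; split.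
  by exists d => M; rewrite /sqfree_series; case: ifP => [/andP[_ /eqP ->]|]; rewrite ?eqxx.
move=> k g gb M; have [h gK hK] := permvar_bij k gb.
rewrite /sqfree_series mdeg_rename (perm_uniq (perm_rename _ _)).
rewrite (map_inj_uniq (can_inj gK)) (perm_size (perm_rename _ _)) size_map.
by [].
Qed.

Lemma pow_subst_polysym m (f : PLambda) : pow_subst_series m f \in polysym.
Proof.
have /polysymP[[n hn] hs] := valP f; apply/polysymP; split.
  exists (m * n)%N => M; rewrite /pow_subst_series.
  case: ifP => [/allP h /hn hM|]; last by rewrite eqxx.
  apply: leq_trans (leq_mul (leqnn m) hM).
  have hd x : (m %| M x)%N.
    by have [/h//|] := boolP (x \in (M : seq var)); rewrite -mset_eq0 => /eqP ->.
  have -> : mdeg M = (m * mdeg (mroot m M))%N; last exact: leqnn.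
  rewrite !mdegE big_distrr /=; have -> : finsupp (mroot m M) = finsupp M.
    apply/fsetP => x; rewrite !mem_finsupp mrootE -{2}(divnK (hd x)) muln_eq0.
    by rewrite (gtn_eqF (pvalP m)) orbF.
  by apply: eq_bigr => x _; rewrite mrootE mulnA [(m * _)%N]mulnC divnK.
move=> k g gb M; have [h gK hK] := permvar_bij k gb.
rewrite /pow_subst_series -(hs k g gb (mroot m M)).
have -> : mroot m (rename (permvar k g) M) = rename (permvar k g) (mroot m M).
  by apply/msetP => x; rewrite mrootE !(renameE _ _ gK hK) mrootE.
suff -> : all (fun x => m %| rename (permvar k g) M x)%N (rename (permvar k g) M) =
          all (fun x => m %| M x)%N M by [].
rewrite (perm_all _ (perm_rename _ _)) all_map; apply: eq_all => x /=.
by rewrite (renameE _ _ gK hK) gK.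
Qed.

Definition psum (k r : posnat) : PLambda := PolySym (psum_polysym k r).

Definition pow_subst (m : posnat) (f : PLambda) : PLambda :=
  PolySym (pow_subst_polysym m f).

Definition Eplus1 (d : posnat) : PLambda := PolySym (sqfree_polysym 1 d).
Definition Eminus1 (d : posnat) : PLambda := PolySym (sqfree_polysym (-1) d).

Definition ptens (tau : ptype) : PLambda :=
  \prod_(k <- degrees tau) \prod_(r <- restr tau k) psum k r.

Definition Eplus (delta : seq block) : PLambda :=
  \prod_(b <- delta) pow_subst b.2 (Eplus1 b.1).

Definition Eminus (delta : seq block) : PLambda :=
  \prod_(b <- delta) pow_subst b.2 (Eminus1 b.1).

(* Rows and columns are numbered from 0; a row number out of range gets length 0. *)
Definition rowlen (tau : ptype) (k : posnat) (i : nat) : nat :=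
  nth 0%N [seq pval r | r <- restr tau k] i.

(* The cell in column c of row i of the k-th component is ((k, i), c). *)
Definition cell : Type := (posnat * nat * nat)%type.

Definition tdg (tau : ptype) : {fset cell} :=
  seq_fset tt [seq (ki, c) | ki <- [seq (k, i) | k <- degrees tau,
                                              i <- iota 0 (size (restr tau k))],
                             c <- iota 0 (rowlen tau ki.1 ki.2)].

Lemma mem_tdg tau k i c : (((k, i), c) \in tdg tau) = (c < rowlen tau k i)%N.
Proof.
rewrite seq_fsetE; apply/allpairsPdep/idP => [[ki [c' [_ hc' [e ->]]]]|hc].
  by move: hc'; rewrite -e mem_iota.
exists (k, i), c; split; rewrite ?mem_iota //.
have hi : (i < size (restr tau k))%N.
  by rewrite ltnNge -(size_map pval); apply: contraL hc => h; rewrite /rowlen nth_default.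
apply/allpairsPdep; exists k, i; split; rewrite ?mem_iota //.
rewrite mem_undup; move: (leq_ltn_trans (leq0n i) hi); rewrite /restr size_map size_filter -has_count.
by case/hasP => b hb /eqP <-; apply: map_f.
Qed.

Definition filling (tau : ptype) (s : nat) : Type := {ffun tdg tau -> 'I_s.+1}.
HB.instance Definition _ tau s := Finite.on (filling tau s).

Section Tableaux.
Variables (tau sigma : ptype) (delta : seq block).
Local Notation s := (size delta).
Implicit Types (T : filling tau s) (i : 'I_s) (rho : ptype).

(* The blocks of delta are numbered from 0; the block number i goes with the entry
   i + 1 of a filling, which is lift ord0 i. *)
Definition dblock i : block := tnth (in_tuple delta) i.

(* Only used for rows of the diagram; these are nonempty. *)
Definition row_filled T (a : 'I_s.+1) (k : posnat) (j : nat) : bool :=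
  [forall u : tdg tau, ((val u).1 == (k, j)) ==> (T u == a)].

Definition rowlens T (a : 'I_s.+1) (k : posnat) : seq nat :=
  [seq rowlen tau k j | j <- iota 0 (size (restr tau k)) & row_filled T a k j].

Definition const_rows T : Prop :=
  forall u v : tdg tau, (val u).1 = (val v).1 -> T u = T v.

Definition zeros_sigma T : Prop :=
  forall k, perm_eq (rowlens T ord0 k) [seq pval r | r <- restr sigma k].

Definition is_rho T i rho : Prop :=
  type_size rho = (dblock i).1 /\
  forall k, perm_eq (rowlens T (lift ord0 i) k)
                    [seq ((dblock i).2 * r)%N | r : posnat <- restr rho k].

Definition incr_rows T : Prop :=
  forall (k : posnat) (j j' : nat) (u v : tdg tau),
    val u = (k, j, 0%N) -> val v = (k, j', 0%N) ->
    rowlen tau k j = rowlen tau k j' -> (j <= j')%N -> (T u <= T v)%N.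

Definition is_ICRHT T : Prop :=
  [/\ const_rows T, zeros_sigma T, forall i, exists rho, is_rho T i rho
    & incr_rows T].

Definition ICRHT : {set filling tau s} := [set T | `[< is_ICRHT T >]].

Lemma is_rho_unique T i rho rho' : is_rho T i rho -> is_rho T i rho' -> rho = rho'.
Proof.
move=> [_ h] [_ h']; apply: ptype_eq => k.
have inj : injective (fun r : posnat => ((dblock i).2 * r)%N).
  move=> a b /eqP; rewrite eqn_mul2l (gtn_eqF (pvalP _)) /=.
  by move/eqP/val_inj.
by apply: (perm_map_inj inj); rewrite -(permPl (h k)).
Qed.

(* The type rho^(i) of T; it is unique by is_rho_unique and exists if T is in ICRHT. *)
Definition rho_of T i : ptype := xget ptype0 [set rho | is_rho T i rho]%classic.

Definition wt T : rat := \prod_(i < s) (ztens (rho_of T i))%:R^-1.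

Definition sgn_plus T : rat :=
  \prod_(i < s) ((-1) ^+ size (rho_of T i) * tsgn (rho_of T i)).

Definition sgn_minus T : rat := \prod_(i < s) (-1) ^+ size (rho_of T i).

End Tableaux.

(* Main.v *)
From HB Require Import structures.
Require Import Defs.
From mathcomp Require Import all_boot all_order all_algebra.
From mathcomp Require Import finmap multiset.
From mathcomp Require Import boolp classical_sets functions fsbigop.
From mathcomp Require Import ring.

Set Implicit Arguments.
Unset Strict Implicit.
Unset Printing Implicit Defensive.

Import GRing.Theory Num.Theory.

Local Open Scope ring_scope.

(** The two identities are the cases eps = 1 and eps = -1 of one identity, and the
    proof combines an algebraic expansion with a bijection.

    The sum over d of sqfree eps d * t^d is the product of the 1 + eps * x_{k,j} * t^k
    over all variables. Taking the logarithm and then the exponential gives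
    sqfree eps d = the sum over rho ||- d of expcoef eps rho * p_rho, where expcoef eps rho
    is the product of - (- eps)^m over the blocks k^m of rho, divided by z_rho. Generating
    functions are avoided by differentiating in t: both sides satisfy Newton's recurrence
      d * F_d = sum over blocks b = k^m of k * (- (- eps)^m) * p_b * F_{d - k m}
    (psum_exp_newton and sqfree_newton), hence agree (sqfree_psum_exp).

    The substitution of x^m for every variable x is an algebra morphism that sends the
    power sum of index r to the one of index m * r. So the product of p_sigma with
    E_delta becomes a sum over the families of types rho^(i) ||- d_i; the term of such a
    family is the product of its coefficients times p_tau, where tau is the union of
    sigma and of the scaled types m_i rho^(i) (product_expansion).

    Finally, such a family is the same as a tableau of shape tau: the rows of a given
    length in a given component are filled increasingly, so the tableau is determined
    by the number of times each entry occurs among them, and those numbers are the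
    multiplicities of the parts of sigma and of the m_i rho^(i) (has_content_inj,
    has_content_exists, ICRHT_sum). Since the weight and the signs of a tableau depend
    only on its types rho^(i), collecting the families by tau gives the theorem. *)

(** * Types as multisets of blocks *)

Lemma geblock_total : total geblock.
Proof.
move=> [a1 a2] [b1 b2]; rewrite /geblock /= -!val_eqE /=.
by case: ltngtP => //= _; exact: leq_total.
Qed.

Definition mktype (s : seq block) : ptype :=
  PType (sort_sorted geblock_total s).

Lemma perm_mktype (s : seq block) : perm_eq (mktype s) s.
Proof. by rewrite /= perm_sort. Qed.

Lemma ptype_perm_inj (t u : ptype) : perm_eq t u -> t = u.
Proof.
by move=> h; apply/val_inj/(sorted_eq geblock_trans geblock_anti (valP t) (valP u)).
Qed.

Lemma mktype_perm (t : ptype) (s : seq block) : perm_eq t s -> mktype s = t.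
Proof.
by move=> h; apply/ptype_perm_inj; rewrite (permPl (perm_mktype s)) perm_sym.
Qed.

(** Both z of a tensor diagram and the power sums of a type are defined degree by
    degree; regrouping turns such products into products over the blocks. *)
Lemma big_degrees (R : Type) (idx : R) (op : Monoid.com_law idx) (tau : ptype)
    (s : seq block) (F : block -> R) : {subset s <= (tau : seq block)} ->
  \big[op/idx]_(k <- degrees tau) \big[op/idx]_(b <- s | b.1 == k) F b =
  \big[op/idx]_(b <- s) F b.
Proof.
move=> hs; rewrite (exchange_big_dep predT) //= big_seq [RHS]big_seq.
apply: eq_bigr => b /hs hb; rewrite big_mkcond (bigD1_seq b.1) ?undup_uniq //=.
  by rewrite eqxx big1 ?Monoid.mulm1 // => k /negPf kb; rewrite eq_sym kb.
by rewrite mem_undup map_f.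
Qed.

Lemma ptensE (tau : ptype) : ptens tau = \prod_(b <- tau) psum b.1 b.2.
Proof.
rewrite -(@big_degrees _ _ _ tau) //; apply: eq_bigr => k _.
by rewrite big_map big_filter; apply: eq_bigr => b /eqP ->.
Qed.

Lemma count_restr (tau : ptype) k r : count_mem r (restr tau k) = count_mem (k, r) tau.
Proof.
rewrite /restr count_map count_filter; apply: eq_count => -[a b] /=.
by rewrite xpair_eqE andbC.
Qed.

Lemma ztensE (tau : ptype) :
  ztens tau = (\prod_(b <- undup tau) (b.2 ^ count_mem b tau * (count_mem b tau)`!))%N.
Proof.
rewrite -(@big_degrees _ _ muln tau) => [|b]; last by rewrite mem_undup.
apply: eq_bigr => k _.
have P : perm_eq (undup (restr tau k)) [seq b.2 | b <- undup tau & b.1 == k].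
  apply: uniq_perm => [||r]; first exact: undup_uniq.
    rewrite map_inj_in_uniq ?filter_uniq ?undup_uniq // => -[a1 a2] [b1 b2].
    by rewrite !mem_filter /= => /andP[/eqP -> _] /andP[/eqP -> _] ->.
  rewrite mem_undup; apply/mapP/mapP => -[b hb ->]; exists b => //.
    by move: hb; rewrite !mem_filter mem_undup.
  by move: hb; rewrite !mem_filter mem_undup.
rewrite /zpart (perm_big _ P) big_map big_filter; apply: eq_bigr => -[a r] /= /eqP ->.
by rewrite count_restr.
Qed.

(** Blocks that do not occur contribute 1, so two types can be compared over a common
    range of blocks. *)
Lemma ztens_sub (tau : ptype) (s : seq block) : uniq s -> {subset (tau : seq block) <= s} ->
  ztens tau = (\prod_(b <- s) (b.2 ^ count_mem b tau * (count_mem b tau)`!))%N.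
Proof.
move=> us hs; rewrite ztensE [RHS](bigID (fun b => b \in (tau : seq block))) /=.
rewrite [X in (_ * X)%N]big1 ?muln1 => [|b /count_memPn ->]; last by rewrite expn0.
rewrite -[RHS]big_filter; apply: perm_big; apply: uniq_perm => [||b].
- exact: undup_uniq.
- exact: filter_uniq.
- by rewrite mem_undup mem_filter; case: (boolP (b \in _)) => // /hs.
Qed.

Lemma ztens_gt0 (tau : ptype) : (0 < ztens tau)%N.
Proof.
rewrite ztensE prodn_cond_gt0 // => b _.
by rewrite muln_gt0 expn_gt0 fact_gt0 (pvalP b.2).
Qed.

Definition tcons (b : block) (tau : ptype) : ptype := mktype (b :: tau).

Lemma perm_tcons b (tau : ptype) : perm_eq (tcons b tau) (b :: tau).
Proof. exact: perm_mktype. Qed.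

Definition bsize (b : block) : nat := (b.1 * b.2)%N.

Lemma bsize_gt0 b : (0 < bsize b)%N.
Proof. by rewrite muln_gt0 !pvalP. Qed.

Lemma type_size_tcons b tau : type_size (tcons b tau) = (bsize b + type_size tau)%N.
Proof. by rewrite /type_size (perm_big _ (perm_tcons b tau)) big_cons. Qed.

Lemma ptens_tcons b tau : ptens (tcons b tau) = psum b.1 b.2 * ptens tau.
Proof. by rewrite !ptensE (perm_big _ (perm_tcons b tau)) big_cons. Qed.

(** Adding one copy of b = d^m, and so raising its multiplicity to c, multiplies
    m^(c-1) * (c-1)! by m * c. *)
Lemma ztens_tcons b tau :
  ztens (tcons b tau) = (b.2 * count_mem b (tcons b tau) * ztens tau)%N.
Proof.
have pt := perm_tcons b tau; set s := undup (b :: tau).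
have us : uniq s by exact: undup_uniq.
have bs : b \in s by rewrite mem_undup mem_head.
rewrite (ztens_sub us) => [|x]; last by rewrite (perm_mem pt) mem_undup.
rewrite [in RHS](ztens_sub us) => [|x]; last by rewrite mem_undup inE orbC => ->.
rewrite !(bigD1_seq b) //= mulnA; congr (_ * _)%N.
  rewrite !(seq.permP pt) /= eqxx add1n expnS factS.
  by rewrite -!mulnA; congr (_ * _)%N; rewrite mulnCA.
apply: eq_bigr => x xb.
by rewrite !(seq.permP pt) /= eq_sym (negPf xb).
Qed.

Definition trem (b : block) (tau : ptype) : ptype := mktype (rem b tau).

Lemma tconsK b : cancel (tcons b) (trem b).
Proof.
move=> tau; apply: mktype_perm.
have hb : b \in (tcons b tau : seq block).
  by rewrite (perm_mem (perm_tcons b tau)) mem_head.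
rewrite -(perm_cons b) perm_sym -(permPl (perm_to_rem hb)).
exact: perm_tcons.
Qed.

Lemma tremK b (tau : ptype) : b \in (tau : seq block) -> tcons b (trem b tau) = tau.
Proof.
move=> h; apply: mktype_perm; rewrite (permPl (perm_to_rem h)) perm_cons perm_sym.
exact: perm_mktype.
Qed.

Definition psucc (n : nat) : posnat := Posnat (ltn0Sn n).

Lemma psuccK (p : posnat) : psucc p.-1 = p.
Proof. by apply/val_inj; rewrite /= prednK ?pvalP. Qed.

(** A finite range that contains every block of size at most n, see bsize_block_box. *)
Definition block_box (n : nat) : seq block :=
  [seq (psucc k, psucc r) | k <- iota 0 n, r <- iota 0 n].

Lemma block_box_uniq n : uniq (block_box n).
Proof.
apply: allpairs_uniq; rewrite ?iota_uniq // => -[a b] [c d] _ _ /= [-> ->] //.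
Qed.

Lemma mem_block_box n (b : block) : (b \in block_box n) = (b.1 <= n)%N && (b.2 <= n)%N.
Proof.
case: b => k r /=; apply/allpairsP/andP => [[[a c] [/= + + [-> ->]]]|[hk hr]].
  by rewrite !mem_iota.
exists (k.-1, r.-1) => /=.
by rewrite !mem_iota !add0n !prednK ?pvalP // !psuccK.
Qed.

Lemma bsize_block_box n (b : block) : (bsize b <= n)%N -> b \in block_box n.
Proof.
move=> h; rewrite mem_block_box; apply/andP; split; apply: leq_trans h.
  by rewrite leq_pmulr ?pvalP.
by rewrite leq_pmull ?pvalP.
Qed.

(** Lists every type of size at most n, possibly with repetitions and together with
    some larger types: a type has at most as many blocks as its size. *)
Fixpoint types_upto (n : nat) : seq ptype :=
  if n is n'.+1 then
    ptype0 :: [seq tcons b t | b <- block_box n, t <- types_upto n']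
  else [:: ptype0].

Lemma mem_types_upto n t : (type_size t <= n)%N -> t \in types_upto n.
Proof.
elim: n t => [|n IH] t; case E : (blocks t) => [|b s].
- by move=> _; rewrite inE; apply/eqP/val_inj.
- have hb : b \in (t : seq block) by rewrite E mem_head.
  by rewrite -(tremK hb) type_size_tcons leqn0 addn_eq0 (gtn_eqF (bsize_gt0 b)).
- by move=> _; rewrite inE; apply/orP; left; apply/eqP/val_inj.
have hb : b \in (t : seq block) by rewrite E mem_head.
rewrite -(tremK hb) type_size_tcons => h; rewrite inE; apply/orP; right.
apply/allpairsP; exists (b, trem b t); split => //=.
  by rewrite bsize_block_box // (leq_trans (leq_addr _ _) h).
by rewrite IH // -ltnS (leq_trans _ h) // -add1n leq_add2r bsize_gt0.
Qed.

Lemma types_upto0 n : ptype0 \in types_upto n.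
Proof. by apply: mem_types_upto; rewrite /type_size big_nil. Qed.

Definition types_of (n : nat) : seq ptype :=
  undup [seq t <- types_upto n | type_size t == n].

Lemma types_of_uniq n : uniq (types_of n).
Proof. exact: undup_uniq. Qed.

Lemma mem_types_of n t : (t \in types_of n) = (type_size t == n).
Proof.
rewrite mem_undup mem_filter; case: eqP => //= <-.
by rewrite mem_types_upto.
Qed.

(** * The exponential of the power sums *)

Lemma sum_count (T : eqType) (s t : seq T) (F : T -> nat) : uniq s -> {subset t <= s} ->
  (\sum_(b <- t) F b = \sum_(b <- s) count_mem b t * F b)%N.
Proof.
move=> us ts; transitivity (\sum_(b <- t) \sum_(c <- s | c == b) F c)%N.
  rewrite big_seq [RHS]big_seq; apply: eq_bigr => b /ts bs.
  rewrite [RHS]big_mkcond (bigD1_seq b) //= eqxx big1 ?addn0 // => c /negPf -> //.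
rewrite (exchange_big_dep predT) //=; apply: eq_bigr => c _.
rewrite big_const_seq iter_addn addn0 mulnC; congr (_ * _)%N.
by apply: eq_count => b; rewrite /= eq_sym.
Qed.

(** These are the c_m for which log(1 + eps * x) is the sum of c_m * x^m / m. *)
Definition logcoef (eps : rat) (m : nat) : rat := - (- eps) ^+ m.

(** The coefficient of p_rho in the exponential of the sum of c_m * p_m(x_{k*}) / m
    over all k and m, where c_m = logcoef eps m. *)
Definition expcoef (eps : rat) (rho : ptype) : rat :=
  (\prod_(b <- rho) logcoef eps b.2) / (ztens rho)%:R.

Definition psum_exp (eps : rat) (n : nat) : PLambda :=
  \sum_(t <- types_of n) expcoef eps t *: ptens t.

(** The multiplicity of b on the left cancels against the one in z (ztens_tcons), and
    so does the multiplicity b.2 in the size of b, which leaves the degree b.1. *)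
Lemma expcoef_tcons eps b t :
  (count_mem b (tcons b t) * bsize b)%:R * expcoef eps (tcons b t) =
  b.1%:R * logcoef eps b.2 * expcoef eps t.
Proof.
rewrite /expcoef (perm_big _ (perm_tcons b t)) big_cons ztens_tcons /bsize.
have z0 : (ztens t)%:R != 0 :> rat by rewrite pnatr_eq0 -lt0n ztens_gt0.
have b0 : b.2%:R != 0 :> rat by rewrite pnatr_eq0 -lt0n pvalP.
have c0 : (count_mem b (tcons b t))%:R != 0 :> rat.
  by rewrite pnatr_eq0 -lt0n -has_count has_pred1 (perm_mem (perm_tcons b t)) mem_head.
have F (k m c l p z : rat) : m != 0 -> c != 0 -> z != 0 ->
    c * (k * m) * (l * p / (m * c * z)) = k * l * (p / z).
  by move=> m0' c0' z0'; field; rewrite z0' c0' m0'.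
by rewrite !natrM; apply: F.
Qed.

Lemma psum_exp0 eps : psum_exp eps 0 = 1.
Proof.
have -> : psum_exp eps 0 = \sum_(t <- [:: ptype0]) expcoef eps t *: ptens t.
  apply: perm_big; apply: uniq_perm => [||t]; rewrite ?types_of_uniq //.
  rewrite mem_types_of inE /type_size; case E : (blocks t) => [|b s].
    by rewrite big_nil; apply/esym/eqP/val_inj.
  rewrite big_cons addn_eq0 (gtn_eqF (bsize_gt0 b)) /=.
  by apply/esym/negP => /eqP h; rewrite h in E.
rewrite big_seq1 /expcoef ptensE ztensE !big_nil divr1 scale1r //.
Qed.

(** The size n of a type is the sum of the sizes of its blocks. Distributing n over
    the distinct blocks b of t and removing one copy of b from t turns the sum over
    pairs (t, b) into a sum over pairs (b, a type of size n - |b|). *)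
Lemma psum_exp_newton eps n :
  n%:R *: psum_exp eps n =
  \sum_(b <- block_box n | (bsize b <= n)%N)
     (b.1%:R * logcoef eps b.2) *: (psum b.1 b.2 * psum_exp eps (n - bsize b)).
Proof.
rewrite scaler_sumr.
transitivity (\sum_(t <- types_of n) \sum_(b <- block_box n | b \in (t : seq block))
    ((count_mem b t * bsize b)%:R * expcoef eps t) *: ptens t).
  rewrite big_seq [RHS]big_seq; apply: eq_bigr => t.
  rewrite mem_types_of => /eqP ht; rewrite scalerA -scaler_suml -mulr_suml -natr_sum.
  congr ((_%:R * _) *: _).
  rewrite -[LHS]ht /type_size (@sum_count _ (block_box n)) ?block_box_uniq //; last first.
    move=> b hb; apply: bsize_block_box.
    by rewrite -(tremK hb) type_size_tcons in ht; rewrite -ht leq_addr.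
  rewrite [RHS]big_mkcond; apply: eq_bigr => b _.
  by case: (boolP (b \in _)) => // /count_memPn ->.
rewrite (exchange_big_dep predT) //= [RHS]big_mkcond; apply: eq_bigr => b _.
case: leqP => hb; last first.
  rewrite big_seq_cond big1 // => t; rewrite mem_types_of => /andP[/eqP ht bt].
  by rewrite -(tremK bt) type_size_tcons in ht; rewrite -ht ltnNge leq_addr in hb.
have P : perm_eq [seq t : ptype <- types_of n | b \in (t : seq block)]
                 [seq tcons b t | t <- types_of (n - bsize b)].
  apply: uniq_perm; rewrite ?filter_uniq ?types_of_uniq //.
    by rewrite map_inj_uniq ?types_of_uniq //; apply: can_inj (tconsK b).
  move=> t; rewrite mem_filter mem_types_of; apply/andP/mapP => [[bt /eqP ht]|[u]].
    exists (trem b t); last by rewrite tremK.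
    by rewrite mem_types_of -ht -{2}(tremK bt) type_size_tcons addKn.
  rewrite mem_types_of => /eqP hu ->.
  by rewrite (perm_mem (perm_tcons b u)) mem_head type_size_tcons hu subnKC.
rewrite -big_filter (perm_big _ P) big_map /psum_exp mulr_sumr scaler_sumr.
apply: eq_bigr => t _.
by rewrite expcoef_tcons -scalerAr scalerA -ptens_tcons.
Qed.

(** * Square-free monomials and Newton's recurrence *)

Lemma perm_msetD (A B : mono) : perm_eq (A `+` B)%mset ((A : seq var) ++ B).
Proof.
apply/allP => x _ /=; apply/eqP.
by rewrite count_cat !count_mem_mset msetE2.
Qed.

Lemma msetn_subset q (x : var) (M : mono) : (msetn q x `<=` M)%mset = (q <= M x)%N.
Proof.
apply/msubsetP/idP => [/(_ x)|h y]; first by rewrite msetnxx.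
by rewrite msetnE; case: eqP => // ->.
Qed.

(** In degree k the power sum p_q has only the monomials x^q, so a divisor of M that
    contributes is given by a variable x of degree k with x^q dividing M. *)
Lemma psum_seriesM (k q : posnat) (g : series) (M : mono) :
  (psum_series k q * g) M =
  \sum_(x <- finsupp M | (x.1 == k) && (q <= M x)%N) g (M `\` msetn q x)%mset.
Proof.
rewrite -[LHS]/(seriesM _ _ M) /seriesM.
have P : perm_eq [seq A <- mdivisors M | `[< exists j, A = msetn q (k, j) >]]
    [seq (msetn q x : mono) | x <- finsupp M & (x.1 == k) && (q <= M x)%N].
  apply: uniq_perm; first by rewrite filter_uniq ?fset_uniq.
    rewrite map_inj_uniq ?filter_uniq ?fset_uniq // => x y /(congr1 (fun A : mono => A x)).
    rewrite msetnxx msetnE; case: eqP => // _ q0.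
    by have := pvalP q; rewrite q0.
  move=> A; rewrite mem_filter mem_mdivisors; apply/andP/mapP.
    move=> [/asboolP[j ->]]; rewrite msetn_subset => h; exists (k, j) => //.
    by rewrite mem_filter /= eqxx h mem_finsupp -lt0n (leq_trans (pvalP q) h).
  move=> [[k' j]]; rewrite mem_filter /= => /andP[/andP[/eqP -> h] _] ->.
  by rewrite msetn_subset h; split => //; apply/asboolP; exists j.
transitivity (\sum_(A <- mdivisors M | `[< exists j, A = msetn q (k, j) >])
    g (M `\` A)%mset); last by rewrite -big_filter (perm_big _ P) big_map big_filter.
rewrite [RHS]big_mkcond /=; apply: eq_bigr => A _.
by rewrite /psum_series; case: asboolP => _; rewrite ?mul1r ?mul0r.
Qed.

Definition sqfree_sign (eps : rat) (M : mono) : rat :=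
  if uniq M then eps ^+ size M else 0.

Lemma sqfree_sign_msetn eps (N : mono) x i : x \notin N ->
  sqfree_sign eps (N `+` msetn i x)%mset =
  (if (i <= 1)%N then eps ^+ i else 0) * sqfree_sign eps N.
Proof.
move=> xN; have P := perm_msetD N (msetn i x).
rewrite /sqfree_sign (perm_uniq P) (perm_size P) cat_uniq size_cat enum_msetn size_nseq.
have -> : has (mem (N : seq var)) (nseq i x) = false.
  by apply/hasPn => y /nseqP[-> _].
case: i {P} => [|[|i]] /=; first by rewrite andbT addn0 mul1r.
  by rewrite andbT addn1 exprS expr1; case: ifP; rewrite ?mulr0.
by rewrite mem_head andbF mul0r.
Qed.

(** Newton's identity one variable at a time, that is, the coefficients of
    (1 + eps x) * x * log(1 + eps x)' = eps x. Removing x^(r+1) leaves a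
    square-free monomial only if at most one copy of x is left, so at most two terms
    survive; they cancel if M contains x at least twice. *)
Lemma sqfree_sign_newton eps (M : mono) x : x \in M ->
  \sum_(r < M x) logcoef eps r.+1 * sqfree_sign eps (M `\` msetn r.+1 x)%mset =
  sqfree_sign eps M.
Proof.
rewrite in_mset => Mx; pose N : mono := (M `\` msetn (M x) x)%mset.
have Nx : x \notin N by rewrite -mset_eq0 msetE2 msetnxx subnn.
have E i : (i <= M x)%N -> (M `\` msetn (M x - i)%N x)%mset = (N `+` msetn i x)%mset.
  move=> iM; apply/msetP => y; rewrite !msetE2 !msetnE; case: eqP => [->|_].
    by rewrite subnn add0n subKn.
  by rewrite !subn0 addn0.
have EM : M = (N `+` msetn (M x) x)%mset.
  by rewrite -(E _ (leqnn _)) subnn msetn0 msetB0.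
rewrite [in RHS]EM sqfree_sign_msetn //.
rewrite (eq_bigr (fun r : 'I_(M x) => logcoef eps r.+1 *
    (if (M x - r.+1 <= 1)%N then eps ^+ (M x - r.+1) else 0) * sqfree_sign eps N)); last first.
  move=> r _; rewrite -mulrA -(sqfree_sign_msetn _ _ Nx); congr (_ * sqfree_sign _ _).
  by rewrite -E ?leq_subr ?subKn.
rewrite -mulr_suml; congr (_ * _).
case: (M x) Mx => // -[|q] _.
  by rewrite big_ord1 /logcoef subnn /=; ring.
rewrite big_ord_recr big_ord_recr /= big1 => [|r _].
  by rewrite !subSS subnn subSnn /logcoef /=; rewrite !exprS; ring.
by rewrite !subSS leqNgt ltn_subRL addn1 !ltnS ltn_ord /= mulr0.
Qed.

Definition sqfree (eps : rat) (d : nat) : PLambda := PolySym (sqfree_polysym eps d).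

Lemma sqfreeE eps d (M : mono) :
  (sqfree eps d : series) M = if mdeg M == d then sqfree_sign eps M else 0.
Proof.
by rewrite /= /sqfree_series /sqfree_sign; case: uniq; case: eqP.
Qed.

Lemma PLambda_sumE I (r : seq I) (P : pred I) (F : I -> PLambda) (M : mono) :
  ((\sum_(i <- r | P i) F i : PLambda) : series) M = \sum_(i <- r | P i) (F i : series) M.
Proof. by apply: (big_morph (fun f : PLambda => (f : series) M)). Qed.

Lemma mdeg_msetB q (x : var) (M : mono) : (q <= M x)%N ->
  mdeg M = (x.1 * q + mdeg (M `\` msetn q x)%mset)%N.
Proof.
move=> h; rewrite -{1}(msetBDKC (_ : msetn q x `<=` M)%mset) ?msetn_subset //.
by rewrite mdegD /mdeg enum_msetn big_nseq iter_addn addn0 mulnC.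
Qed.

(** At a monomial M of degree n, the sum over blocks b = k^r becomes a sum over the
    variables x of M and the powers r <= M x, and sqfree_sign_newton evaluates the
    inner sums: what remains is the sum of the degrees of the distinct variables of M,
    which is n if M is square-free. *)
Lemma sqfree_newton eps n :
  n%:R *: sqfree eps n =
  \sum_(b <- block_box n | (bsize b <= n)%N)
     (b.1%:R * logcoef eps b.2) *: (psum b.1 b.2 * sqfree eps (n - bsize b)).
Proof.
apply/val_inj/funext => M; rewrite /= PLambda_sumE.
rewrite (eq_bigr (fun b : block => \sum_(x <- finsupp M | (x.1 == b.1) && (b.2 <= M x)%N)
    if mdeg M == n
    then b.1%:R * (logcoef eps b.2 * sqfree_sign eps (M `\` msetn b.2 x)%mset)
    else 0)); last first.
  move=> b hb.
  rewrite -[LHS]/((b.1%:R * logcoef eps b.2) *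
    (psum_series b.1 b.2 * (sqfree eps (n - bsize b) : series) : series) M).
  rewrite psum_seriesM mulr_sumr; apply: eq_bigr => x /andP[/eqP xb hx].
  rewrite sqfreeE (mdeg_msetB hx) xb -/(bsize b).
  rewrite -{2}(subnKC hb) eqn_add2l; case: eqP => _; first by rewrite mulrA.
  by rewrite mulr0.
rewrite -[LHS]/(n%:R * (sqfree eps n : series) M) sqfreeE.
case: eqP => [hM|_]; last first.
  by rewrite mulr0 big1 // => b _; rewrite big1.
have -> : n%:R = \sum_(x <- finsupp M) (M x * x.1)%:R :> rat.
  by rewrite -hM mdegE natr_sum.
rewrite mulr_suml (exchange_big_dep predT) //=.
rewrite big_seq [RHS]big_seq; apply: eq_bigr => x; rewrite msuppE => xM.
have hx : (x.1 * M x <= n)%N by rewrite -hM (mdeg_msetB (leqnn (M x))) leq_addr.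
have P : perm_eq [seq b <- block_box n | (bsize b <= n)%N && ((x.1 == b.1) && (b.2 <= M x)%N)]
    [seq (x.1, psucc r) | r <- iota 0 (M x)].
  apply: uniq_perm; rewrite ?filter_uniq ?block_box_uniq //.
    by rewrite map_inj_uniq ?iota_uniq // => a c [].
  move=> [k r]; rewrite mem_filter /=; apply/andP/mapP.
    move=> [/and3P[_ /eqP -> hr] _]; exists r.-1; rewrite ?psuccK //.
    by rewrite mem_iota add0n prednK ?pvalP.
  move=> [i]; rewrite mem_iota add0n => hi [-> ->] /=.
  have hs : (bsize (x.1, psucc i) <= n)%N.
    by apply: leq_trans hx; rewrite leq_mul2l; apply/orP; right.
  by rewrite hs eqxx hi; split => //; apply: bsize_block_box.
rewrite -big_filter (perm_big _ P) big_map /=.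
have -> : iota 0 (M x) = index_iota 0 (M x) by rewrite /index_iota subn0.
rewrite big_mkord -mulr_sumr sqfree_sign_newton // natrM -mulrA mulrCA; congr (_ * _).
rewrite /sqfree_sign; case: ifP => [uM|_]; last by rewrite mulr0.
by rewrite -count_mem_mset count_uniq_mem // xM mul1r.
Qed.

(** The expansion of E^+_d (eps = 1) and E_d (eps = -1) in power sums: both sides
    satisfy the same recurrence, which determines them from their value in degree 0. *)
Lemma sqfree_psum_exp eps n : sqfree eps n = psum_exp eps n.
Proof.
elim/ltn_ind: n => -[_|n IH].
  rewrite psum_exp0; apply/val_inj/funext => M; rewrite -[LHS]/((sqfree eps 0 : series) M) sqfreeE.
  rewrite -[RHS]/(series1 M) /series1.
  have [->|M0] := eqVneq M mset0.
    by rewrite /mdeg /sqfree_sign enum_mset0 big_nil eqxx /= expr0.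
  case: eqP => // M0'; case/negP: M0; apply/eqP/msetP => x; rewrite mset0E.
  apply/eqP; rewrite mset_eq0; apply/negP; rewrite in_mset => hx.
  have := mdeg_msetB hx; rewrite M0' muln1 => /eqP.
  by rewrite eq_sym addn_eq0 (gtn_eqF (pvalP _)).
have n0 : n.+1%:R != 0 :> rat by rewrite pnatr_eq0.
apply: (scalerI n0); rewrite sqfree_newton psum_exp_newton; apply: eq_bigr => b hb.
by rewrite IH // ltn_subrL bsize_gt0.
Qed.

(** * Powers of the variables *)

Definition mpow (m : posnat) (N : mono) : mono :=
  [fsfun x in finsupp N => (m * N x)%N].

Lemma mpowE m (N : mono) x : mpow m N x = (m * N x)%N.
Proof.
rewrite /mpow fsfunE; case: ifP => // /negbT.
by rewrite memNfinsupp => /eqP ->; rewrite muln0.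
Qed.

Lemma mpowK m : cancel (mpow m) (mroot m).
Proof. by move=> N; apply/msetP => x; rewrite mrootE mpowE mulKn ?pvalP. Qed.

Lemma mpowB m (A B : mono) : (mpow m A `\` mpow m B)%mset = mpow m (A `\` B)%mset.
Proof. by apply/msetP => x; rewrite !(mpowE, msetE2) mulnBr. Qed.

Lemma mpow_subset m (A B : mono) : (mpow m A `<=` mpow m B)%mset = (A `<=` B)%mset.
Proof.
by apply/msubsetP/msubsetP => h x; have := h x; rewrite !mpowE leq_pmul2l ?pvalP.
Qed.

Lemma mono_dvdP (m : posnat) (M : mono) :
  reflect (forall x, m %| M x)%N (all (fun x => m %| M x)%N M).
Proof.
apply: (iffP allP) => h x // ; have [/h //|] := boolP (x \in (M : seq var)).
by rewrite -mset_eq0 => /eqP ->.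
Qed.

Lemma pow_subst_mpow m f (N : mono) : pow_subst_series m f (mpow m N) = f N.
Proof.
rewrite /pow_subst_series mpowK; case: mono_dvdP => // -[] x.
by rewrite mpowE dvdn_mulr.
Qed.

Lemma pow_subst_notpow m f (M : mono) :
  (forall N, M <> mpow m N) -> pow_subst_series m f M = 0.
Proof.
rewrite /pow_subst_series => h; case: mono_dvdP => // hd; case: (h (mroot m M)).
by apply/msetP => x; rewrite mpowE mrootE mulnC divnK.
Qed.

(** A factorization of N^m into two m-th powers is the m-th power of a factorization
    of N, and a product of m-th powers is an m-th power. *)
Lemma pow_subst_seriesM m (f g : series) :
  pow_subst_series m (f * g) = pow_subst_series m f * pow_subst_series m g.
Proof.
apply/funext => M; rewrite -[RHS]/(seriesM _ _ M) /seriesM.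
have [[N ->]|h] := pselect (exists N, M = mpow m N); last first.
  rewrite pow_subst_notpow => [|N eN]; last by apply: h; exists N.
  rewrite big_seq big1 // => A; rewrite mem_mdivisors => hA.
  have [[B eB]|hB] := pselect (exists B, A = mpow m B); last first.
    by rewrite pow_subst_notpow ?mul0r // => B eB; apply: hB; exists B.
  rewrite mulrC pow_subst_notpow ?mul0r // => C eC; apply: h; exists (B `+` C)%mset.
  rewrite -(msetBDKC hA) eC eB.
  by apply/msetP => x; rewrite !(mpowE, msetE2) mulnDr.
rewrite pow_subst_mpow -[LHS]/(\sum_(B <- mdivisors N) f B * g (N `\` B)%mset).
have P : perm_eq [seq A : mono <- mdivisors (mpow m N) | all (fun x => m %| A x)%N A]
    [seq mpow m B | B <- mdivisors N].
  apply: uniq_perm; rewrite ?filter_uniq ?fset_uniq //.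
    by rewrite map_inj_uniq ?fset_uniq //; apply: can_inj (mpowK m).
  move=> A; rewrite mem_filter mem_mdivisors; apply/andP/mapP.
    move=> [/mono_dvdP hA hAN]; have eA : A = mpow m (mroot m A).
      by apply/msetP => x; rewrite mpowE mrootE mulnC divnK.
    by exists (mroot m A); rewrite // mem_mdivisors -(mpow_subset m) -eA.
  move=> [B]; rewrite mem_mdivisors => hB ->; rewrite mpow_subset; split => //.
  by apply/mono_dvdP => x; rewrite mpowE dvdn_mulr.
rewrite [RHS](bigID (fun A : mono => all (fun x => m %| A x)%N A)) /=.
rewrite -[X in _ = X + _]big_filter (perm_big _ P).
rewrite big_map [X in _ = _ + X]big1 ?addr0 => [|A /negPf hA]; last first.
  by rewrite {1}/pow_subst_series hA mul0r.
by apply: eq_bigr => B _; rewrite mpowB !pow_subst_mpow.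
Qed.

Lemma pow_subst_linear m : linear (pow_subst m).
Proof.
move=> a f g; apply/val_inj/funext => M; rewrite /= /pow_subst_series.
rewrite -[RHS]/(a * (if all (fun x => m %| M x)%N M then (f : series) (mroot m M) else 0)
  + (if all (fun x => m %| M x)%N M then (g : series) (mroot m M) else 0)).
by case: ifP => // _; rewrite mulr0 addr0.
Qed.

Lemma pow_subst_monoid m : monoid_morphism (pow_subst m).
Proof.
split=> [|f g]; last by apply/val_inj; rewrite /= pow_subst_seriesM.
apply/val_inj/funext => M; rewrite -[LHS]/(pow_subst_series m series1 M).
rewrite -[RHS]/(series1 M).
have [[N ->]|h] := pselect (exists N, M = mpow m N).
  rewrite pow_subst_mpow /series1; congr (nat_of_bool _)%:R.
  have e0 : mpow m mset0 = mset0 by apply/msetP => x; rewrite mpowE !mset0E muln0.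
  by rewrite -{2}e0 (can_eq (mpowK m)).
rewrite pow_subst_notpow => [|N eN]; last by apply: h; exists N.
rewrite /series1; case: eqP => // M0; case: h; exists mset0.
by apply/msetP => x; rewrite M0 mpowE !mset0E muln0.
Qed.

HB.instance Definition _ m :=
  GRing.isLinear.Build rat PLambda PLambda _ (pow_subst m) (pow_subst_linear m).
HB.instance Definition _ m :=
  GRing.isMonoidMorphism.Build PLambda PLambda (pow_subst m) (pow_subst_monoid m).

Definition posM (m r : posnat) : posnat :=
  Posnat (etrans (muln_gt0 m r) (introT andP (conj (pvalP m) (pvalP r)))).

Lemma pow_subst_psum m k r : pow_subst m (psum k r) = psum k (posM m r).
Proof.
apply/val_inj/funext => M; rewrite /= /psum_series.
have E j : mpow m (msetn r (k, j)) = msetn (m * r)%N (k, j).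
  by apply/msetP => x; rewrite mpowE !msetnE; case: eqP => //; rewrite muln0.
have [[N ->]|h] := pselect (exists N, M = mpow m N).
  rewrite pow_subst_mpow; congr (nat_of_bool _)%:R; apply: asbool_equiv_eq.
  split=> -[j]; first by move=> ->; exists j; rewrite E.
  by rewrite -E => /(can_inj (mpowK m)) ->; exists j.
rewrite pow_subst_notpow => [|N eN]; last by apply: h; exists N.
case: asboolP => // -[j eM]; case: h; exists (msetn r (k, j)).
by rewrite E.
Qed.

Definition tscale (m : posnat) (tau : ptype) : ptype :=
  mktype [seq (b.1, posM m b.2) | b <- tau].

Lemma pow_subst_ptens m tau : pow_subst m (ptens tau) = ptens (tscale m tau).
Proof.
rewrite !ptensE rmorph_prod (perm_big _ (perm_mktype _)) big_map.
by apply: eq_bigr => b _; rewrite /= pow_subst_psum.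
Qed.

Lemma pow_subst_sqfree m eps d :
  pow_subst m (sqfree eps d) = \sum_(t <- types_of d) expcoef eps t *: ptens (tscale m t).
Proof.
rewrite sqfree_psum_exp linear_sum; apply: eq_bigr => t _.
by rewrite linearZ /= pow_subst_ptens.
Qed.

(** * Tableaux with a given content *)

Definition rows (tau : ptype) (k : posnat) (r : nat) : seq nat :=
  [seq j <- iota 0 (size (restr tau k)) | rowlen tau k j == r].

Lemma mem_rows tau k r j : (0 < r)%N -> (j \in rows tau k r) = (rowlen tau k j == r).
Proof.
move=> r0; rewrite mem_filter mem_iota /= add0n; case: eqP => //= e.
rewrite ltnNge; apply/negP => h; move: r0.
by rewrite -e /rowlen nth_default // size_map.
Qed.

Lemma size_rows tau k (r : posnat) : size (rows tau k r) = count_mem (k, r) tau.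
Proof.
rewrite -count_restr size_filter.
rewrite -[RHS](count_map pval (pred1 (pval r))).
rewrite -(mkseq_nth 0%N [seq pval x | x <- restr tau k]) size_map /mkseq count_map.
exact: eq_count.
Qed.

Lemma rows_sorted tau k r : sorted ltn (rows tau k r).
Proof. exact: sorted_filter ltn_trans _ _ (iota_ltn_sorted _ _). Qed.

Lemma rows_uniq tau k r : uniq (rows tau k r).
Proof. by rewrite filter_uniq ?iota_uniq. Qed.

(** The common entry of a row, read off its first cell; the value ord0 for a row
    outside the diagram is arbitrary. *)
Definition rowval tau s (T : filling tau s) (k : posnat) (j : nat) : 'I_s.+1 :=
  if insub ((k, j), 0%N) is Some u then T u else ord0.

Lemma rowvalE tau delta (T : filling tau (size delta)) (u : tdg tau) :
  const_rows T -> T u = rowval T (val u).1.1 (val u).1.2.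
Proof.
case: u => [[[k j] c] hu] cT; rewrite /rowval /=; case: insubP => [v _ ev|/negP[]].
  by apply: cT; rewrite ev.
by move: hu; rewrite !mem_tdg; apply: leq_ltn_trans.
Qed.

Lemma rowval_cell tau s (T : filling tau s) (u : tdg tau) k j :
  val u = (k, j, 0%N) -> rowval T k j = T u.
Proof.
move=> eu; rewrite /rowval; case: insubP => [v _ ev|/negP[]]; last first.
  by rewrite -eu (valP u).
by congr (T _); apply/val_inj; rewrite /= ev eu.
Qed.

Lemma row_filledE tau delta (T : filling tau (size delta)) a k j :
  const_rows T -> (0 < rowlen tau k j)%N -> row_filled T a k j = (rowval T k j == a).
Proof.
move=> cT; rewrite -mem_tdg => h; pose u : tdg tau := FSetSub h.
apply/forallP/eqP => [/(_ u)/implyP/(_ (eqxx _))/eqP <-|e v].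
  by rewrite (@rowval_cell _ _ _ u).
by apply/implyP => /eqP ev; rewrite (rowvalE _ cT) ev e.
Qed.

Lemma rowlen_gt0 tau k j : (j < size (restr tau k))%N -> (0 < rowlen tau k j)%N.
Proof.
move=> h; have : rowlen tau k j \in [seq pval r | r <- restr tau k].
  by apply: mem_nth; rewrite size_map.
by case/mapP => r _ ->; exact: pvalP.
Qed.

Lemma count_rowlens tau delta (T : filling tau (size delta)) a k r : const_rows T ->
  count_mem r (rowlens T a k) = count_mem a [seq rowval T k j | j <- rows tau k r].
Proof.
move=> cT; rewrite /rowlens !count_map !count_filter; apply: eq_in_count => j.
rewrite mem_iota add0n /= => hj.
by rewrite row_filledE ?rowlen_gt0 //= andbC.
Qed.

(** The conditions on a tableau for given types rho^(i), put in a uniform way: kappa 0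
    is the type of the 0-cells and kappa (i+1) the type of the cells that contain i+1,
    which is the scaled type m_i rho^(i). *)
Definition has_content tau delta (T : filling tau (size delta))
    (kappa : 'I_(size delta).+1 -> ptype) : Prop :=
  [/\ const_rows T, incr_rows T &
      forall a k, perm_eq (rowlens T a k) [seq pval r | r <- restr (kappa a) k]].

Lemma count_pval_restr tau k (r : posnat) :
  count_mem (pval r) [seq pval x | x <- restr tau k] = count_mem (k, r) tau.
Proof. by rewrite -count_restr count_map. Qed.

(** The content condition in terms of multiplicities: it counts how often an entry a
    occurs among the rows of each length r. *)
Lemma perm_rowlensP tau delta (T : filling tau (size delta)) kappa a k : const_rows T ->
  reflect (forall r : posnat,
     count_mem a [seq rowval T k j | j <- rows tau k r] = count_mem (k, r) (kappa : ptype))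
    (perm_eq (rowlens T a k) [seq pval r | r <- restr kappa k]).
Proof.
move=> cT; apply: (iffP idP) => [/seq.permP h r|h].
  by rewrite -count_rowlens // h count_pval_restr.
apply/allP => x hx /=; have [r ->] : exists r : posnat, x = r.
  move: hx; rewrite mem_cat => /orP[|/mapP[r _ ->]]; last by exists r.
  case/mapP => j; rewrite mem_filter mem_iota add0n => /andP[_ /rowlen_gt0 hj] ->.
  by exists (Posnat hj).
by rewrite count_rowlens // h count_pval_restr.
Qed.

Definition tunion n (kappa : 'I_n -> ptype) : ptype :=
  mktype (flatten [seq (kappa a : seq block) | a <- enum 'I_n]).

Lemma count_tunion n (kappa : 'I_n -> ptype) b :
  count_mem b (tunion kappa) = (\sum_(a < n) count_mem b (kappa a))%N.
Proof.
rewrite (seq.permP (perm_mktype _)) count_flatten sumnE 2!big_map big_enum //.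
Qed.

Lemma ptens_tunion n (kappa : 'I_n -> ptype) :
  ptens (tunion kappa) = \prod_(a < n) ptens (kappa a).
Proof.
rewrite ptensE (perm_big _ (perm_mktype _)) big_flatten big_map big_enum /=.
by apply: eq_bigr => a _; rewrite ptensE.
Qed.

Lemma sum_count_mem (I : finType) (l : seq I) : (\sum_(a : I) count_mem a l = size l)%N.
Proof.
elim: l => /= [|x l IH]; first by rewrite big1.
rewrite big_split /= IH (bigD1 x) //= eqxx big1 ?addn0 ?add1n // => y /negPf.
by rewrite eq_sym => ->.
Qed.

(** Every row carries exactly one entry, so the rows of the shape are distributed among
    the types of the content. *)
Lemma has_content_shape tau delta (T : filling tau (size delta)) kappa :
  has_content T kappa -> tau = tunion kappa.
Proof.
move=> [cT _ hT]; apply: ptype_perm_inj; apply/allP => -[k r] _; apply/eqP.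
rewrite -size_rows count_tunion -(size_map (rowval T k)).
under eq_bigr => a _ do rewrite -(elimT (perm_rowlensP _ _ _ cT) (hT a k)).
by rewrite sum_count_mem.
Qed.

Definition leord n : rel 'I_n := fun a b => (a <= b)%N.
Lemma leord_trans n : transitive (@leord n).
Proof. by move=> b a c; apply: leq_trans. Qed.
Lemma leord_anti n : antisymmetric (@leord n).
Proof. by move=> a b h; apply/val_inj/anti_leq. Qed.
Lemma leord_total n : total (@leord n).
Proof. by move=> a b; apply: leq_total. Qed.

Lemma rowvals_sorted tau delta (T : filling tau (size delta)) k r :
  (0 < r)%N -> incr_rows T -> sorted (@leord _) [seq rowval T k j | j <- rows tau k r].
Proof.
move=> r0 iT; rewrite sorted_map.
apply: (@sub_in_sorted _ (fun j => j \in rows tau k r) ltn) (rows_sorted tau k r).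
  move=> i j; rewrite -!topredE /= !mem_rows // => /eqP hi /eqP hj ij.
  have ui : ((k, i), 0%N) \in tdg tau by rewrite mem_tdg hi.
  have uj : ((k, j), 0%N) \in tdg tau by rewrite mem_tdg hj.
  rewrite (@rowval_cell _ _ _ (FSetSub ui)) // (@rowval_cell _ _ _ (FSetSub uj)) //.
  by apply: (iT k i j); rewrite ?hi ?hj // ltnW.
by apply/allP.
Qed.

(** The entries of the rows of a given length form a weakly increasing sequence whose
    multiplicities are dictated by the content. *)
Lemma has_content_inj tau delta (T T' : filling tau (size delta)) kappa :
  has_content T kappa -> has_content T' kappa -> T = T'.
Proof.
move=> [cT iT hT] [cT' iT' hT']; apply/ffunP => u.
rewrite (rowvalE _ cT) (rowvalE _ cT').
case: u => [[[k j] c] hu] /=; move: hu; rewrite mem_tdg => /(leq_ltn_trans (leq0n c)) hj.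
pose r := Posnat hj; have jr : j \in rows tau k r by rewrite mem_rows.
suff /eq_in_map/(_ j jr) : [seq rowval T k i | i <- rows tau k r] =
    [seq rowval T' k i | i <- rows tau k r] by [].
apply: (sorted_eq (@leord_trans _) (@leord_anti _)).
- by apply: rowvals_sorted; rewrite ?pvalP.
- by apply: rowvals_sorted; rewrite ?pvalP.
apply/allP => a _; apply/eqP.
exact: etrans (elimT (perm_rowlensP _ _ _ cT) (hT a k) r)
  (esym (elimT (perm_rowlensP _ _ _ cT') (hT' a k) r)).
Qed.

(** Conversely, the sorted sequence with the multiplicities dictated by the content is
    written into the rows of each length, from top to bottom. *)
Lemma has_content_exists delta (kappa : 'I_(size delta).+1 -> ptype) :
  exists T : filling (tunion kappa) (size delta), has_content T kappa.
Proof.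
set tau := tunion kappa; set s := size delta in kappa tau *.
(* The entries of the rows of length r in component k, from top to bottom. *)
pose L k r : seq 'I_s.+1 := sort (@leord _) (flatten
  [seq nseq (count_mem r [seq pval x | x <- restr (kappa a) k]) a | a <- enum 'I_s.+1]).
pose V k j := nth ord0 (L k (rowlen tau k j)) (index j (rows tau k (rowlen tau k j))).
have cL k (r : posnat) a : count_mem a (L k r) = count_mem (k, r) (kappa a).
  rewrite count_sort count_flatten sumnE 2!big_map big_enum /= (bigD1 a) //=.
  rewrite count_nseq /= eqxx mul1n count_pval_restr big1 ?addn0 // => b ba.
  by rewrite count_nseq /= (negPf ba).
have sL k (r : posnat) : size (L k r) = size (rows tau k r).
  rewrite size_rows count_tunion -(eq_bigr _ (fun a _ => cL k r a)).
  by rewrite sum_count_mem.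
have VL k (r : posnat) : [seq V k j | j <- rows tau k r] = L k r.
  apply: (@eq_from_nth _ ord0) => [|i]; rewrite size_map ?sL // => hi.
  rewrite (nth_map 0%N) // /V.
  have /eqP -> : rowlen tau k (nth 0%N (rows tau k r) i) == r.
    by rewrite -mem_rows ?pvalP // mem_nth.
  by rewrite index_uniq ?rows_uniq.
pose T : filling tau s := [ffun u => V (val u).1.1 (val u).1.2].
have cT : const_rows T by move=> u v e; rewrite !ffunE e.
have rT k j : (0 < rowlen tau k j)%N -> rowval T k j = V k j.
  by rewrite -mem_tdg => h; rewrite (@rowval_cell _ _ _ (FSetSub h)) // ffunE.
exists T; split => //.
  move=> k j j' u v eu ev ejj' jj'; rewrite !ffunE eu ev /= /V -ejj'.
  have hj : (0 < rowlen tau k j)%N by rewrite -mem_tdg -eu (valP u).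
  pose r := Posnat hj; rewrite -[rowlen tau k j]/(pval r).
  have mj : j \in rows tau k r by rewrite mem_rows.
  have mj' : j' \in rows tau k r by rewrite mem_rows // -ejj'.
  apply: (sorted_leq_nth (@leord_trans _) _ ord0 (sort_sorted (@leord_total _) _)).
  - by move=> a; apply: leqnn.
  - by rewrite inE sL index_mem.
  - by rewrite inE sL index_mem.
  rewrite leqNgt; apply/negP => /(sorted_ltn_index ltn_trans (rows_sorted tau k r)).
  by move=> /(_ mj' mj); rewrite ltnNge jj'.
move=> a k; apply/(perm_rowlensP _ _ _ cT) => r; rewrite -cL -VL.
congr (count_mem a); apply/eq_in_map => j; rewrite mem_rows ?pvalP // => /eqP e.
by rewrite rT // e pvalP.
Qed.

(** * The expansion of the product *)

Definition content (sigma : ptype) (delta : seq block)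
    (rho : 'I_(size delta) -> ptype) (a : 'I_(size delta).+1) : ptype :=
  if unlift ord0 a is Some i then tscale (dblock i).2 (rho i) else sigma.

Lemma perm_restr (t : ptype) (s : seq block) k : perm_eq t s ->
  perm_eq (restr t k) [seq b.2 | b <- s & b.1 == k].
Proof. by move=> h; apply/perm_map/perm_filter. Qed.

Lemma perm_restr_tscale m (tau : ptype) k :
  perm_eq [seq pval r | r <- restr (tscale m tau) k] [seq (m * r)%N | r : posnat <- restr tau k].
Proof.
rewrite (permPl (perm_map _ (perm_restr k (perm_mktype _)))) filter_map -!map_comp.
by rewrite (eq_map (g := fun b : block => (m * b.2)%N)).
Qed.

Lemma has_contentP tau sigma delta (T : filling tau (size delta)) rho :
  (forall i, type_size (rho i) = (dblock i).1) ->
  has_content T (content sigma rho) <->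
  [/\ const_rows T, zeros_sigma sigma T, forall i, is_rho T i (rho i) & incr_rows T].
Proof.
move=> hs; split=> [[cT iT hT]|[cT zT rT iT]]; split => //.
- by move=> k; have := hT ord0 k; rewrite /content unlift_none.
- move=> i; split=> [|k]; first exact: hs.
  by have := hT (lift ord0 i) k; rewrite /content liftK (permPr (perm_restr_tscale _ _ _)).
- move=> a k; rewrite /content; case: unliftP => [i|] ->; last exact: zT.
  by rewrite (permPr (perm_restr_tscale _ _ _)); have [_] := rT i; apply.
Qed.

Lemma rho_ofE tau delta (T : filling tau (size delta)) i rho :
  is_rho T i rho -> rho_of T i = rho.
Proof.
move=> h; apply: is_rho_unique (h).
have : exists r, is_rho T i r by exists rho.
by move/(xgetPex ptype0).
Qed.

Lemma ICRHT_content tau sigma delta (T : filling tau (size delta)) :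
  T \in ICRHT tau sigma delta ->
  (forall i, type_size (rho_of T i) = (dblock i).1) /\ has_content T (content sigma (rho_of T)).
Proof.
rewrite inE => /asboolP[cT zT eT iT].
have rT i : is_rho T i (rho_of T i) by have [r hr] := eT i; rewrite (rho_ofE hr).
have hs i : type_size (rho_of T i) = (dblock i).1 by have [] := rT i.
by split => //; apply/has_contentP.
Qed.

Lemma content_ICRHT tau sigma delta (T : filling tau (size delta)) rho :
  (forall i, type_size (rho i) = (dblock i).1) -> has_content T (content sigma rho) ->
  T \in ICRHT tau sigma delta /\ rho_of T =1 rho.
Proof.
move=> hs /(has_contentP _ _ hs)[cT zT rT iT]; split=> [|i]; last exact: rho_ofE.
by rewrite inE; apply/asboolP; split => // i; exists (rho i).
Qed.

Lemma ptens_content sigma delta (rho : 'I_(size delta) -> ptype) :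
  ptens (tunion (content sigma rho)) =
  ptens sigma * \prod_(i < size delta) ptens (tscale (dblock i).2 (rho i)).
Proof.
rewrite ptens_tunion big_ord_recl /content unlift_none; congr (_ * _).
by apply: eq_bigr => i _; rewrite liftK.
Qed.

(** The sums over types of different sizes d_i are put on a common finite index type,
    so that a product of such sums can be distributed. *)
Lemma sum_types_of (V : nmodType) (n d : nat) (F : ptype -> V) : (d <= n)%N ->
  \sum_(t <- types_of d) F t =
  \sum_(x : seq_sub (types_upto n) | type_size (val x) == d) F (val x).
Proof.
move=> dn; have P : perm_eq (types_of d)
    [seq val x | x <- index_enum (seq_sub (types_upto n)) & type_size (val x) == d].
  apply: uniq_perm; first exact: types_of_uniq.
    by rewrite map_inj_uniq ?filter_uniq ?index_enum_uniq //; apply: val_inj.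
  move=> t; rewrite mem_types_of; apply/eqP/mapP => [ht|[x + ->]].
    have tn : t \in types_upto n by apply: mem_types_upto; rewrite ht.
    exists (SeqSub tn) => //.
    by rewrite mem_filter /= ht eqxx mem_index_enum.
  by rewrite mem_filter => /andP[/eqP].
by rewrite (perm_big _ P) big_map big_filter.
Qed.

Section Expansion.
Variables (eps : rat) (sigma : ptype) (delta : seq block).
Let s := size delta.
Let n := (\max_(b <- delta) b.1)%N.
Let D := seq_sub (types_upto n).

Definition rho_family : pred {ffun 'I_s -> D} :=
  family (fun i => [pred x : D | type_size (val x) == (dblock i).1]).

Let shape (f : {ffun 'I_s -> D}) : ptype := tunion (content sigma (fun i => val (f i))).
Let weight (f : {ffun 'I_s -> D}) : rat := \prod_(i < s) expcoef eps (val (f i)).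

Lemma dblock_le (i : 'I_s) : ((dblock i).1 <= n)%N.
Proof.
exact: (leq_bigmax_seq (F := fun b : block => pval b.1) _ (mem_tnth i (in_tuple delta)) isT).
Qed.

Lemma product_expansion :
  ptens sigma * \prod_(b <- delta) pow_subst b.2 (sqfree eps b.1) =
  \sum_(f | f \in rho_family) weight f *: ptens (shape f).
Proof.
rewrite big_tnth; under eq_bigr => i _ do
  rewrite pow_subst_sqfree (sum_types_of _ (dblock_le i)).
rewrite bigA_distr_big_dep mulr_sumr /=; apply: eq_bigr => f _.
by rewrite /shape ptens_content scaler_prod scalerAr.
Qed.

(** The tableaux of shape tau correspond to the families of types rho^(i) whose content
    has union tau: a tableau determines its types, and given the types it is unique by
    has_content_inj and exists by has_content_exists. *)
Lemma ICRHT_sum tau (G : ('I_s -> ptype) -> rat) :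
  \sum_(T in ICRHT tau sigma delta) G (rho_of T) =
  \sum_(f | (f \in rho_family) && (shape f == tau)) G (fun i => val (f i)).
Proof.
pose Phi (T : filling tau s) : {ffun 'I_s -> D} :=
  [ffun i => insubd (SeqSub (types_upto0 n)) (rho_of T i)].
have PhiE T i : T \in ICRHT tau sigma delta -> val (Phi T i) = rho_of T i.
  move=> /ICRHT_content[hs _]; rewrite ffunE val_insubd ifT //.
  by rewrite mem_types_upto // hs dblock_le.
have rhoE T : T \in ICRHT tau sigma delta -> rho_of T = fun i => val (Phi T i).
  by move=> hT; apply/funext => i; rewrite PhiE.
have contE T : T \in ICRHT tau sigma delta ->
    has_content T (content sigma (fun i => val (Phi T i))).
  by move=> hT; have [_] := ICRHT_content hT; rewrite rhoE.
have inj : {in ICRHT tau sigma delta &, injective Phi}.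
  move=> T T' hT hT' e; apply: has_content_inj (contE T hT) _.
  by rewrite e; apply: contE.
transitivity (\sum_(T in ICRHT tau sigma delta) G (fun i => val (Phi T i))).
  by apply: eq_bigr => T hT; rewrite rhoE.
rewrite -(big_imset (fun f : {ffun 'I_s -> D} => G (fun i => val (f i))) inj).
apply: eq_bigl => f; apply/imsetP/andP => [[T hT ->]|[hf /eqP e]].
  have [hs _] := ICRHT_content hT; split.
    by apply/familyP => i; rewrite inE PhiE // hs.
  by rewrite /shape -(has_content_shape (contE T hT)).
have hs i : type_size (val (f i)) = (dblock i).1.
  by move/familyP: hf => /(_ i); rewrite inE => /eqP.
have [T hT] := has_content_exists (content sigma (fun i => val (f i))).
rewrite -/(shape f) in T hT; move: T hT; rewrite e => T hT.
have [hI hr] := content_ICRHT hs hT.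
by exists T => //; apply/ffunP => i; apply/val_inj; rewrite PhiE.
Qed.

(** Only the finitely many types that occur as a shape contribute to the sum over tau,
    and every family of types rho^(i) occurs under exactly one of them. *)
Lemma ICRHT_expansion :
  ptens sigma * \prod_(b <- delta) pow_subst b.2 (sqfree eps b.1) =
  \sum_(tau \in [set: ptype]%classic)
    (\sum_(T in ICRHT tau sigma delta) \prod_(i < s) expcoef eps (rho_of T i)) *: ptens tau.
Proof.
rewrite product_expansion.
pose A := [fset shape f | f in {: {ffun 'I_s -> D}}]%fset.
pose weights (rho : 'I_s -> ptype) := \prod_(i < s) expcoef eps (rho i).
rewrite (@fsbigTE _ _ _ _ A) => [|tau htau].
  under [RHS]eq_bigr => tau _ do rewrite (ICRHT_sum tau weights) scaler_suml.
  rewrite (exchange_big_dep (fun f => f \in rho_family)) /= => [|tau f _ /andP[] //].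
  apply: eq_bigr => f hf; rewrite big_mkcond (bigD1_seq (shape f)) ?fset_uniq //=.
    rewrite hf eqxx big1 ?addr0 // => tau; rewrite eq_sym => /negPf ->.
    by rewrite andbF.
  exact: in_imfset.
rewrite (ICRHT_sum tau weights) big1 ?scale0r // => f /andP[_ /eqP e].
by case/negP: htau; rewrite -e; apply: in_imfset.
Qed.

End Expansion.

Lemma prodrN_seq (R : comPzRingType) (I : Type) (l : seq I) (F : I -> R) :
  \prod_(b <- l) - F b = (-1) ^+ size l * \prod_(b <- l) F b.
Proof.
elim: l => [|b l IH]; first by rewrite !big_nil mulr1.
by rewrite !big_cons IH /= exprS mulN1r !mulNr mulrCA.
Qed.

(* The outer sums run over all types; \sum_(tau \in [set: ptype]) is the sum of the
   finitely many nonzero terms. *)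
Theorem theorem49 (sigma : ptype) (delta : seq block) :
  ptens sigma * Eplus delta =
    \sum_(tau \in [set: ptype]%classic)
      (\sum_(T in ICRHT tau sigma delta) sgn_plus T * wt T) *: ptens tau
  /\
  ptens sigma * Eminus delta =
    \sum_(tau \in [set: ptype]%classic)
      (\sum_(T in ICRHT tau sigma delta) sgn_minus T * wt T) *: ptens tau.
Proof.
split.
- apply: etrans (ICRHT_expansion 1 sigma delta) _; apply: eq_fsbigr => tau _.
  congr (_ *: _); apply: eq_bigr => T _; rewrite /sgn_plus /wt -big_split.
  by apply: eq_bigr => i _; rewrite /expcoef prodrN_seq.
- apply: etrans (ICRHT_expansion (-1) sigma delta) _; apply: eq_fsbigr => tau _.
  congr (_ *: _); apply: eq_bigr => T _; rewrite /sgn_minus /wt -big_split.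
  apply: eq_bigr => i _; rewrite /expcoef prodrN_seq opprK /=.
  by rewrite [X in _ * X / _]big1 ?mulr1 // => b _; rewrite expr1n.
Qed.
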